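(* Let $G=\prod_{i=1}^{n}G_i$ be a product of finitely generated acylindrically hyperbolic groups $G_i$. Then $G$ has an ambiguity function that is bounded above by a polynomial of degree $n$.
   Context: $\mathbb{N}$ contains $0$. For a group $G$ with finite generating set $X$, $|g|_X$ denotes word length with respect to $X\cup X^{-1}$; for a subgroup $H\le G$ and $r\in\mathbb{N}$, $B_H^X(r)=\{h\in H:|h|_X\le r\}$. Let $G$ be a group with finite generating set $X$ and $H\le G$ a subgroup. A function $\Phi\colon H\times H\to H$ is a concatenation map of $H$ in $G$ if there is a constant $\varepsilon\in\mathbb{N}$ such that for all $h,k\in H$ one has $\Phi(h,k)=h\,x_{h,k}\,k$ with $x_{h,k}\in B_H^X(\varepsilon)$. For $p,q\in\mathbb{N}$ let $\Phi_{p,q}$ be the restriction of $\Phi$ to $B_H^X(p)\times B_H^X(q)$. A function $f\colon\mathbb{N}\to\mathbb{N}$ is a relative ambiguity function for $\Phi$ (and of $H$ in $G$, with respect to $X$) if $|\Phi_{p,q}^{-1}(g)|\le f(q)$ for all $p,q\in\mathbb{N}$ and all $g\in H$. If $H=G$, $f$ is called an ambiguity function of $G$. Up to precomposing $f$ with multiplication by a constant, this does not depend on the choice of $X$, so the existence of an ambiguity function bounded above by a polynomial of a given degree is independent of $X$. A hyperbolic space is a geodesic metric space that is Gromov hyperbolic. An action of a group $G$ by isometries on a metric space $(\Omega,d)$ is acylindrical if for every $\varepsilon>0$ there are constants $R,N>0$ such that for all $x,y\in\Omega$ with $d(x,y)\ge R$ there are at most $N$ elements $g\in G$ with $d(x,gx)\le\varepsilon$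 and $d(y,gy)\le\varepsilon$. For an action on a hyperbolic space $\Omega$, an element $g$ is loxodromic if $\mathbb{Z}\to\Omega$, $n\mapsto g^n x$, is a quasigeodesic for some (equivalently any) $x$. An acylindrical action of $G$ on a hyperbolic space is elementary if $G$ has bounded orbits, or $G$ is virtually cyclic and contains a loxodromic element; otherwise it is non-elementary. $G$ is acylindrically hyperbolic if it admits a non-elementary acylindrical action on a hyperbolic space. *)

(* Defs.v *)
From HB Require Import structures.
From mathcomp Require Import all_boot all_order all_algebra.
From mathcomp Require Import all_classical all_reals all_analysis.

Set Implicit Arguments.
Unset Strict Implicit.
Unset Printing Implicit Defensive.

Import Order.TTheory GRing.Theory Num.Theory.

Local Open Scope card_scope.
Local Open Scope classical_set_scope.
Local Open Scope ring_scope.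

(* gproduct.v only equips finite products of *finite* groups with a group      *)
(* structure; gprod is an alias so that the two instances cannot overlap.      *)
Definition gprod (I : finType) (G : I -> groupType) : Type :=
  {dffun forall i : I, G i}.

Section GProd.
Variables (I : finType) (G : I -> groupType).
Implicit Types x y z : gprod G.

HB.instance Definition _ := Choice.on (gprod G).

Definition gprod_one : gprod G := [ffun i : I => (1 : G i)%g].
Definition gprod_inv x : gprod G := [ffun i : I => ((x i)^-1 : G i)%g].
Definition gprod_mul x y : gprod G := [ffun i : I => (x i * y i : G i)%g].

Fact gprod_mulA : associative gprod_mul.
Proof. by move=> x y z; apply/ffunP => i; rewrite !ffunE mulgA. Qed.
Fact gprod_mul1 : left_id gprod_one gprod_mul.
Proof. by move=> x; apply/ffunP => i; rewrite !ffunE mul1g. Qed.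
Fact gprod_mul1r : right_id gprod_one gprod_mul.
Proof. by move=> x; apply/ffunP => i; rewrite !ffunE mulg1. Qed.
Fact gprod_mulV : left_inverse gprod_one gprod_inv gprod_mul.
Proof. by move=> x; apply/ffunP => i; rewrite !ffunE mulVg. Qed.
Fact gprod_mulVr : right_inverse gprod_one gprod_inv gprod_mul.
Proof. by move=> x; apply/ffunP => i; rewrite !ffunE mulgV. Qed.

HB.instance Definition _ := isGroup.Build (gprod G)
  gprod_mulA gprod_mul1 gprod_mul1r gprod_mulV gprod_mulVr.

End GProd.

Section Words.
Variable G : groupType.
Implicit Types (X H : set G) (g h k : G).

Definition represents X (s : seq G) g :=
  (forall x, x \in s -> X x \/ X (x^-1)%g) /\ (\prod_(x <- s) x)%g = g.

Definition generates X := forall g, exists s, represents X s g.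

Definition finitely_generated := exists2 X, finite_set X & generates X.

(* The value is 0 when g is not in the subgroup generated by X; the length is  *)
(* only meant to be used when X generates G.                                   *)
Definition word_length X g : nat :=
  match pselect (exists n,
    `[< exists2 s, represents X s g & size s = n >]) with
  | left e => ex_minn e
  | right _ => 0%N
  end.

Definition word_ball X H (r : nat) : set G :=
  [set h | H h /\ (word_length X h <= r)%N].

(* Phi stands for a map H x H -> H: only its values on H x H matter, and for a *)
(* subgroup H the condition below forces them to lie in H.                     *)
Definition concatenation_map X H (Phi : G -> G -> G) :=
  exists eps : nat, forall h k, H h -> H k ->
    exists2 x, word_ball X H eps x & Phi h k = (h * x * k)%g.

Definition ambiguity_function_for X H (Phi : G -> G -> G) (f : nat -> nat) :=
  forall (p q : nat) g, H g ->
    [set hk : G * G | [/\ word_ball X H p hk.1, word_ball X H q hk.2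
                        & Phi hk.1 hk.2 = g]] #<= `I_(f q).

Definition relative_ambiguity_function X H (f : nat -> nat) :=
  exists2 Phi, concatenation_map X H Phi & ambiguity_function_for X H Phi f.

Definition ambiguity_function X (f : nat -> nat) :=
  relative_ambiguity_function X setT f.

Definition expgz g (m : int) : G :=
  match m with
  | Posz k => g ^+ k
  | Negz k => g ^- k.+1
  end%g.

Definition virtually_cyclic := exists c : G,
  finite_set [set [set (expgz c m * h)%g | m in [set: int]] | h in [set: G]].

End Words.

Arguments finitely_generated : clear implicits.
Arguments virtually_cyclic : clear implicits.

Section HyperbolicSpaces.
Variables (R : realType) (M : metricType R).
Implicit Types (x y z w : M).

Definition geodesic_space := forall x y, exists c : R -> M,
  [/\ c 0 = x, c (mdist x y) = y
    & {in `[0, mdist x y]%R &, forall s t, mdist (c s) (c t) = `|s - t|}].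

Definition gromov_product w x y : R :=
  (mdist x w + mdist y w - mdist x y) / 2.

Definition gromov_hyperbolic := exists delta : R, forall w x y z,
  Num.min (gromov_product w x y) (gromov_product w y z) - delta
    <= gromov_product w x z.

Definition hyperbolic_space := geodesic_space /\ gromov_hyperbolic.

Definition quasigeodesic (u : int -> M) := exists L C : R,
  [/\ 1 <= L, 0 <= C & forall m n : int,
    L^-1 * `|m - n|%:~R - C <= mdist (u m) (u n) <= L * `|m - n|%:~R + C].

End HyperbolicSpaces.

Arguments geodesic_space {R} M.
Arguments gromov_hyperbolic {R} M.
Arguments hyperbolic_space {R} M.

Section Actions.
Variables (R : realType) (G : groupType) (M : metricType R).
Implicit Types (act : G -> M -> M).

Definition isometric_action act :=
  [/\ forall x, act 1%g x = x,
      forall g h x, act (g * h)%g x = act g (act h x)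
    & forall g x y, mdist (act g x) (act g y) = mdist x y].

Definition acylindrical act := forall eps : R, 0 < eps ->
  exists (r : R) (N : nat), [/\ 0 < r, (0 < N)%N & forall x y : M,
    r <= mdist x y ->
    [set g | mdist x (act g x) <= eps /\ mdist y (act g y) <= eps] #<= `I_N].

Definition loxodromic act (g : G) :=
  exists x : M, quasigeodesic (fun m : int => act (expgz g m) x).

(* Quantified over all x, so that an action on the empty space is elementary.  *)
Definition bounded_orbits act :=
  forall x : M, exists C : R, forall g, mdist x (act g x) <= C.

Definition elementary act :=
  bounded_orbits act \/
  (virtually_cyclic G /\ exists g, loxodromic act g).

End Actions.

Definition acylindrically_hyperbolic (R : realType) (G : groupType) :=
  exists (M : metricType R) (act : G -> M -> M),
    [/\ hyperbolic_space M, isometric_action act, acylindrical act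
      & ~ elementary act].

(* Main.v *)
Require Import Defs.
From mathcomp Require Import all_boot all_order all_algebra.
From mathcomp Require Import all_classical all_reals all_analysis.
From mathcomp Require Import zify ring lra.

Set Implicit Arguments.
Unset Strict Implicit.
Unset Printing Implicit Defensive.

Import Order.TTheory GRing.Theory Num.Theory.

Local Open Scope card_scope.
Local Open Scope classical_set_scope.
Local Open Scope ring_scope.

(** Let a factor act acylindrically on a hyperbolic space, fix a base point
[o] and write [D g h] for the distance from [g o] to [h o]. Concatenating [h]
and [k] as [h x k] is harmless when [x] is long and makes bounded angles with
what precedes and follows, that is, when the Gromov product at 1 of [h^-1] and
[x] is bounded, and so is that of [x^-1] and [k]. Given three elements whose
directions are pairwise separated, and whose inverses have the same property,
one of them always works: [h^-1] can spoil at most one of the three, and so can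
[k] (connector_choice). For such an [x] and [g = h x k], the points [h o] and
[h x o] lie near a geodesic from [o] to [g o]. Since the distance from [h o] to
[g o] is at most a multiple of the length of [k], there are linearly many
places where [h o] can be; and once this place and [x] are known, both [h o]
and [h x o] are known up to a bounded error, which by acylindricity leaves a
bounded number of [h], hence of [k] (linear_ambiguity). In a product, choose
[x] factor by factor: the bounds multiply, and the product of [n] linear
polynomials has degree [n].

It remains to find arbitrarily long triples of connecting elements, with a
separation constant that does not depend on their length. This uses that the
action is not elementary.

A loxodromic element exists. An isometry whose square displaces a point by
clearly more than the isometry itself does has a quasigeodesic orbit there
(axial_criterion). If there were no such isometry and no bound on the orbits,
then any finite set of elements would displace by a bounded amount, depending
on the hyperbolicity constant only, the points of a long geodesic from [o]
(displacement_bound). Taking more elements than acylindricity allows is a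
contradiction (bounded_orbits_of_no_axis).

Its axis has many translates. The ray of positive powers of a loxodromic [a]
defines an end. An element fixing this end moves every far point of the ray to
within a uniform distance of the axis (ray_shadow), and acylindricity then puts
the stabiliser of the end into finitely many cosets of the powers of [a]
(end_stabiliser_cosets). As the group is not virtually cyclic, the end of [a]
has at least three translates (virtually_cyclic_of_two_ends), and likewise that
of [a^-1]. If they come from [g_1], [g_2], [g_3] and from [h_1], [h_2], [h_3],
then the elements [g_i a^n h_i^-1] with [n] large are the connectors
(connectors_exist).

Hyperbolicity enters through the four-point inequality alone, so every
estimate is a linear inequality between finitely many distances, and no
boundary at infinity has to be constructed. Geodesics are used only to find the
loxodromic element. *)

(** * Four-point geometry *)

Section FourPoint.
Variables (R : realType) (T : Type).

(** Twice the Gromov product of [x] and [y] at [w]: leaving out the division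
by 2 keeps every estimate below an integral linear inequality. *)
Definition gp (d : T -> T -> R) w x y : R := d x w + d y w - d x y.

(** The constant [e] is twice the usual hyperbolicity constant, to match [gp].
A pseudometric suffices, so that an orbit can be pulled back to the group. *)
Record hyperbolic_dist (d : T -> T -> R) (e : R) : Prop := HyperbolicDist {
  dist_refl : forall x, d x x = 0;
  dist_sym : forall x y, d x y = d y x;
  dist_triangle : forall x y z, d x z <= d x y + d y z;
  dist_defect_ge0 : 0 <= e;
  dist_four_point : forall w x y z,
    gp d w x y <= gp d w x z + e \/ gp d w y z <= gp d w x z + e }.

Variables (d : T -> T -> R) (e : R).
Hypothesis hd : hyperbolic_dist d e.

Lemma dist_ge0 x y : 0 <= d x y.
Proof.
have := dist_triangle hd x y x; rewrite (dist_refl hd) (dist_sym hd y x); lra.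
Qed.

Lemma gp_sym w x y : gp d w x y = gp d w y x.
Proof. by rewrite /gp (dist_sym hd x y); ring. Qed.

Lemma gp_le_dist w x y : gp d w x y <= 2 * d w x.
Proof.
have := dist_triangle hd y x w; rewrite /gp (dist_sym hd w x) (dist_sym hd y x).
lra.
Qed.

Lemma gp_move_base v w x y : gp d w x y <= gp d v x y + 2 * d w v.
Proof.
have := (dist_triangle hd x v w, dist_triangle hd y v w).
by rewrite /gp (dist_sym hd v w) => -[]; lra.
Qed.

Lemma gp_move_l w x x' y : gp d w x y <= gp d w x' y + 2 * d x x'.
Proof.
have := (dist_triangle hd x x' w, dist_triangle hd x' x y).
by rewrite /gp (dist_sym hd x' x) => -[]; lra.
Qed.

(** A point of small Gromov product with respect to [x] and [y] lies near a
geodesic from [x] to [y], where it is located by its distance to [x]. *)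
Lemma dist_le_of_gp x y p q A B s :
    gp d p x y <= A -> gp d q x y <= B -> `|d x p - d x q| <= s ->
  d p q <= s + A + B + e.
Proof.
move=> pA qB; rewrite ler_norml => /andP[lo hi].
have e0 := dist_defect_ge0 hd.
have B0 : 0 <= B.
  have := dist_triangle hd x q y; move: qB.
  by rewrite /gp (dist_sym hd y q); lra.
have A0 : 0 <= A.
  have := dist_triangle hd x p y; move: pA.
  by rewrite /gp (dist_sym hd y p); lra.
have := dist_four_point hd p x q y; have := dist_triangle hd x p y.
move: pA qB; rewrite /gp (dist_sym hd q p) (dist_sym hd q y) (dist_sym hd p y).
by move=> xpy [] H pA qB; lra.
Qed.

(** A chain of three segments whose middle one is long compared with the
backtracking at its ends does not backtrack as a whole. *)
Lemma gp_chain x p q y C :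
    gp d p x q <= C -> gp d q p y <= C -> 2 * C + e < 2 * d p q ->
  gp d p x y <= C + e /\ gp d q x y <= C + e.
Proof.
have [[[qp yp] yq] xp] := (dist_sym hd q p, dist_sym hd y p, dist_sym hd y q,
  dist_sym hd x p).
rewrite /gp => pC qC long; split.
  by have [] := dist_four_point hd p x y q; rewrite /gp; lra.
by have [] := dist_four_point hd q p x y; rewrite /gp; lra.
Qed.

End FourPoint.

(** * Elements acting as translations along an axis *)

Section Axis.
Variables (R : realType) (G : groupType) (D : G -> G -> R) (e : R).
Hypothesis hD : hyperbolic_dist D e.
Hypothesis D_left : forall k g h, D (k * g)%g (k * h)%g = D g h.
Implicit Types a g h k : G.

Lemma D_translate k g h : D (k * g)%g h = D g (k^-1 * h)%g.
Proof. by rewrite -(D_left k^-1%g) mulKg. Qed.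

Lemma D_conj g h k : D k (g^-1 * h * k)%g = D (g * k)%g (h * k)%g.
Proof. by rewrite D_translate mulgA. Qed.

Lemma gp_left k w g h : gp D (k * w)%g (k * g)%g (k * h)%g = gp D w g h.
Proof. by rewrite /gp !D_left. Qed.

Lemma D_inv g : D 1%g g^-1%g = D 1%g g.
Proof. by rewrite -(D_left g) mulg1 mulgV (dist_sym hD). Qed.

Lemma D_mulr g h : D g (g * h)%g = D 1%g h.
Proof. by rewrite -[X in D X _]mulg1 D_left. Qed.

Lemma D_mul_le g h : D 1%g (g * h)%g <= D 1%g g + D 1%g h.
Proof. by have := dist_triangle hD 1%g g (g * h)%g; rewrite D_mulr. Qed.

Lemma D_exp a i j : D (a ^+ i)%g (a ^+ (i + j))%g = D 1%g (a ^+ j)%g.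
Proof. by rewrite expgnDr D_mulr. Qed.

Lemma D_expS_le a n : D 1%g (a ^+ n.+1)%g <= D 1%g (a ^+ n)%g + D 1%g a.
Proof. by rewrite expgSr D_mul_le. Qed.

Lemma D_exp_le a n : D 1%g (a ^+ n)%g <= n%:R * D 1%g a.
Proof.
elim: n => [|n IHn]; first by rewrite expg0 (dist_refl hD) mul0r.
rewrite (le_trans (D_expS_le a n))// -addn1 natrD mulrDl mul1r; lra.
Qed.

(** The powers of an axial element trace a quasigeodesic ray: [kappa] bounds
its speed from below and [C] its backtracking. *)
Record axial a (C kappa : R) : Prop := Axial {
  axial_pos : 0 < kappa;
  axial_growth : forall n, n%:R * kappa <= D 1%g (a ^+ n)%g;
  axial_gp : forall i j, (i <= j)%N -> gp D (a ^+ i)%g 1%g (a ^+ j)%g <= C }.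

Section Criterion.
Variable a : G.
Let L := D 1%g a.
Let c := 2 * L - D 1%g (a ^+ 2)%g.
Hypothesis a_long : L + 2 * e < D 1%g (a ^+ 2)%g.

Let D_step n : D (a ^+ n)%g (a ^+ n.+1)%g = L.
Proof. by rewrite -addn1 D_exp expg1. Qed.

Let D_step2 n : D (a ^+ n)%g (a ^+ n.+2)%g = D 1%g (a ^+ 2)%g.
Proof. by rewrite -addn2 D_exp. Qed.

(** If the backtracking at a vertex of the path is at most [c + e] then, edges
being long, so is the backtracking at the next vertex. *)
Let gp_last n : gp D (a ^+ n)%g 1%g (a ^+ n.+1)%g <= c + e.
Proof.
have e0 := dist_defect_ge0 hD; elim: n => [|n IHn].
  have := D_mul_le a a; rewrite -expg2.
  rewrite /gp expg0 (dist_refl hD) expg1 (dist_sym hD a) /c -/L; lra.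
have := dist_four_point hD (a ^+ n.+1)%g (a ^+ n)%g 1%g (a ^+ n.+2)%g.
move: IHn a_long; rewrite /gp !(dist_sym hD _ (a ^+ n.+1)%g).
rewrite (dist_sym hD (a ^+ n.+1)%g (a ^+ n)%g) (dist_sym hD (a ^+ n.+1)%g 1%g).
rewrite (dist_sym hD (a ^+ n)%g 1%g) !D_step D_step2 /c.
by move=> IHn long []; lra.
Qed.

(** An isometry whose square moves the base point substantially further than
the isometry itself translates along an axis: this is the passage from local
to global quasigeodesics. *)
Lemma axial_criterion : axial a (c + 2 * e) (L - c - e).
Proof.
have e0 := dist_defect_ge0 hD; split; first by move: a_long; rewrite /c; lra.
  elim=> [|n IHn]; first by rewrite mul0r (dist_ge0 hD).
  have := gp_last n; rewrite /gp => gn.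
  have [s1 s2] := (dist_sym hD (a ^+ n.+1)%g (a ^+ n)%g, D_step n).
  by rewrite -natr1 mulrDl mul1r; lra.
move=> i j; rewrite leq_eqVlt => /predU1P[->|ij].
  rewrite /gp (dist_refl hD) (dist_sym hD 1%g).
  by have := D_mul_le a a; rewrite -expg2 /c -/L; lra.
have := dist_four_point hD (a ^+ i)%g 1%g (a ^+ j)%g (a ^+ i.+1)%g.
have := gp_last i => gi [|]; first by lra.
(* By homogeneity the second alternative concerns the first edge of the path
from 1 to [a ^+ m.+1], hence also its last edge. *)
rewrite -(subnKC ij) addSnnS; set m := (j - i.+1)%N; have := gp_last m.
have sh : D (a ^+ i.+1)%g (a ^+ (i + m.+1))%g = D 1%g (a ^+ m)%g.
  by rewrite addnS -addSn D_exp.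
have [[s1 s2] s3] := (dist_sym hD (a ^+ (i + m.+1))%g (a ^+ i)%g,
  dist_sym hD (a ^+ i.+1)%g (a ^+ i)%g,
  dist_sym hD (a ^+ (i + m.+1))%g (a ^+ i.+1)%g).
have [[s4 s5] s6] := (D_exp a i m.+1, D_step i, D_step m).
have [s7 s8] := (dist_sym hD 1%g (a ^+ m)%g,
  dist_sym hD (a ^+ m.+1)%g (a ^+ m)%g).
by move: a_long gi; rewrite /gp /c; lra.
Qed.

End Criterion.

End Axis.

(** * Ends of translates of an axis *)

(** Serves to find, among the powers of an element, one at a prescribed distance
from 1; [B] allows the distance to overshoot that of the last power. *)
Lemma discrete_ivt (R : realType) (u : nat -> R) (s B t : R) m :
    u 0%N = 0 -> (forall n, u n.+1 <= u n + s) -> 0 <= s -> 0 <= B ->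
    0 <= t <= u m + B ->
  exists2 i, (i <= m)%N & `|u i - t| <= s + B.
Proof.
move=> u0 us s0 B0; elim: m => [|m IHm] /andP[t0 tm].
  exists 0%N => //; move: tm; rewrite u0 ler_norml; lra.
have [tm'|tm'] := lerP t (u m + B).
  by have [|i im ui] := IHm; [rewrite t0 | exists i => //; exact: leqW].
by exists m.+1 => //; have := us m; rewrite ler_norml; lra.
Qed.

Section Ends.
Variables (R : realType) (G : groupType) (D : G -> G -> R) (e : R).
Hypothesis hD : hyperbolic_dist D e.
Hypothesis D_left : forall k g h, D (k * g)%g (k * h)%g = D g h.
Variables (a : G) (C kappa : R).
Hypothesis axa : axial D a C kappa.
Implicit Types g h k : G.

(** The rays [g a^n] and [h a^n] converge to different boundary points. *)
Definition ends_apart g h :=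
  exists B, forall m n, gp D 1%g (g * a ^+ m)%g (h * a ^+ n)%g <= B.

Lemma ends_apart_sym g h : ends_apart g h -> ends_apart h g.
Proof. by case=> B gh; exists B => m n; rewrite (gp_sym hD). Qed.

Lemma ends_apart_left k g h : ends_apart g h -> ends_apart (k * g)%g (k * h)%g.
Proof.
case=> B gh; exists (B + 2 * D 1%g k) => m n.
rewrite (le_trans (gp_move_base hD k _ _ _))// lerD2r -!mulgA.
by rewrite -{1}[k]mulg1 (gp_left D_left).
Qed.

Definition shadow_radius := D 1%g a + 3 * C + 5 * e.

(** For suitable large [m] and [n], a geodesic from 1 to [g a^n] follows one
from 1 to [a^m] for a long time. It passes near [g a^j] once the ray has left
the ball around 1 that contains its starting point [g], and that ball affects
only how large [j] must be: the radius is the same for all [g]. *)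
Lemma ray_shadow g : ~ ends_apart 1%g g ->
  exists j0, forall j, (j0 <= j)%N ->
    exists i, D (a ^+ i)%g (g * a ^+ j)%g <= shadow_radius.
Proof.
move=> close.
have e0 := dist_defect_ge0 hD; have k0 := axial_pos axa.
have C0 : 0 <= C.
  have := axial_gp axa (leqnn 0).
  by rewrite expg0 /gp (dist_refl hD); lra.
pose A := (C + e + 2 * D 1%g g) / kappa.
have A0 : 0 <= A.
  by rewrite divr_ge0 ?(ltW k0)//; have := dist_ge0 hD 1%g g; lra.
exists (Num.bound A) => j jA; set q := (g * a ^+ j)%g.
have far : C + e + 2 * D 1%g g < 2 * D g q.
  have Aj : A < j%:R.
    by rewrite (lt_le_trans (archi_boundP A0))// ler_nat.
  rewrite /q (D_mulr D_left); have := axial_growth axa j.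
  have : A * kappa < j%:R * kappa by rewrite ltr_pM2r.
  rewrite divfK ?gt_eqF//; have := dist_ge0 hD 1%g (a ^+ j)%g; lra.
have [m [n big]] : exists m n, C + 2 * e + 2 * D 1%g q +
    2 * (D 1%g g + j%:R * D 1%g a) < gp D 1%g (a ^+ m)%g (g * a ^+ n)%g.
  apply: contrapT => small; apply: close.
  exists (C + 2 * e + 2 * D 1%g q + 2 * (D 1%g g + j%:R * D 1%g a)) => m n.
  rewrite mul1g leNgt; apply/negP => big; apply: small; by exists m, n.
have D0 := (dist_ge0 hD 1%g q, dist_ge0 hD 1%g g, dist_ge0 hD 1%g a).
case: D0 => [[Dq Dg] Da]; have jDa : 0 <= j%:R * D 1%g a by rewrite mulr_ge0.
have jn : (j <= n)%N.
  rewrite leqNgt; apply/negP => nj; move: big.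
  rewrite (gp_sym hD) ltNge; apply/negP/negPn.
  apply: (le_trans (gp_le_dist hD _ _ _)).
  have := D_mul_le hD D_left g (a ^+ n)%g; have := D_exp_le hD D_left a n.
  have : n%:R * D 1%g a <= j%:R * D 1%g a by rewrite ler_wpM2r// ler_nat ltnW.
  lra.
have q_gn : gp D q g (g * a ^+ n)%g <= C.
  by rewrite -[X in gp D _ X _]mulg1 (gp_left D_left) (axial_gp axa).
have q_1n : gp D q 1%g (g * a ^+ n)%g <= C + e.
  have [] := dist_four_point hD q g 1%g (g * a ^+ n)%g; last by lra.
  have := dist_triangle hD g 1%g q; rewrite (dist_sym hD g 1%g) => tr.
  by rewrite {1}/gp (dist_sym hD g 1%g); lra.
have q_1m : gp D q 1%g (a ^+ m)%g <= C + 2 * e.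
  have [] := dist_four_point hD q 1%g (a ^+ m)%g (g * a ^+ n)%g; first by lra.
  have := gp_move_base hD q 1%g (a ^+ m)%g (g * a ^+ n)%g.
  by lra.
have [|||||i im ui] := @discrete_ivt R (fun i => D 1%g (a ^+ i)%g) (D 1%g a)
  (C + 2 * e) (D 1%g q) m.
- by rewrite expg0 (dist_refl hD).
- by move=> i; exact: (D_expS_le hD D_left).
- by [].
- by lra.
- apply/andP; split=> //; have := dist_ge0 hD (a ^+ m)%g q; move: q_1m.
  by rewrite /gp; lra.
exists i; have := dist_le_of_gp hD (axial_gp axa im) q_1m ui.
by rewrite /shadow_radius; lra.
Qed.

End Ends.

(** * Counting *)

Lemma card_le_inj T U (A : set T) (B : set U) (phi : T -> U) :
    {in A &, injective phi} -> (forall x, A x -> B (phi x)) -> A #<= B.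
Proof.
move=> phi_inj AB; rewrite -(card_le_eql (inj_card_eq phi_inj)).
by apply: subset_card_le => _ [x Ax <-]; exact: AB.
Qed.

Lemma card_le_II_inj T (A : set T) N : A #<= `I_N ->
  exists2 phi : T -> nat, {in A &, injective phi} &
    forall x, A x -> (phi x < N)%N.
Proof.
by move=> /pcard_leP[f]; exists f; [exact: 'inj_f | exact: (@funS _ _ _ _ f)].
Qed.

Lemma card_le_fibers T (S : set T) (c : T -> nat) Q N :
    (forall x, S x -> (c x < Q)%N) ->
    (forall j, S `&` [set x | c x = j] #<= `I_N) ->
  S #<= `I_(Q * N).
Proof.
move=> cQ /(_ _)/card_le_II_inj fib.
have /choice[phi phiP] : forall j, exists phi : T -> nat,
    {in S `&` [set x | c x = j] &, injective phi} /\
    forall x, (S `&` [set x | c x = j]) x -> (phi x < N)%N.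
  by move=> j; have [phi] := fib j; exists phi.
pose psi x := (c x * N + phi (c x) x)%N.
have phiN x : S x -> (phi (c x) x < N)%N by move=> Sx; apply: (phiP _).2.
apply: (@card_le_inj _ _ _ _ psi) => [x y|x Sx]; last first.
  rewrite /psi /= (@leq_trans ((c x).+1 * N))//; last first.
    by rewrite leq_mul2r cQ ?orbT.
  by rewrite mulSn addnC ltn_add2r phiN.
rewrite !inE => Sx Sy xy.
have N0 : (0 < N)%N by rewrite (leq_ltn_trans _ (phiN _ Sx)).
have cxy : c x = c y.
  have := congr1 (divn^~ N) xy.
  by rewrite /psi /= !divnMDl// !divn_small ?addn0 ?phiN.
apply: ((phiP (c x)).1 x y); rewrite ?inE//.
by move: xy; rewrite /psi -cxy => /addnI.
Qed.

(** * Integral powers *)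

Section IntegralPowers.
Variable G : groupType.
Implicit Types (a h : G) (m n : int).

Let expgzS a m : expgz a (m + 1) = (expgz a m * a)%g.
Proof.
case: m => [k|[|k]].
- by rewrite -[X in _ + X]/(Posz 1) -PoszD addn1 /= expgSr.
- by rewrite /= mulVg.
have -> : Negz k.+1 + 1 = Negz k by lia.
by rewrite /expgz [(a ^+ k.+2)%g]expgS invgM mulgVK.
Qed.

Lemma expgzD a m n : expgz a (m + n) = (expgz a m * expgz a n)%g.
Proof.
elim/int_rect: n => [|n IHn|n IHn]; first by rewrite addr0 mulg1.
  have -> : m + n.+1%:Z = (m + n%:Z) + 1 by lia.
  rewrite expgzS IHn -mulgA -[in LHS](expgzS a n%:Z).
  by congr (_ * expgz _ _)%g; lia.
apply: (mulIg a); rewrite -expgzS -mulgA -expgzS.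
have -> : m - n.+1%:Z + 1 = m - n%:Z by lia.
by rewrite IHn; congr (_ * expgz _ _)%g; lia.
Qed.

Definition zcoset a h : set G := [set (expgz a m * h)%g | m in [set: int]].

Lemma zcoset_mull a m h : zcoset a (expgz a m * h)%g = zcoset a h.
Proof.
apply/seteqP; split=> _ [n _ <-].
  by exists (n + m) => //; rewrite mulgA expgzD.
by exists (n - m) => //; rewrite mulgA -expgzD subrK.
Qed.

End IntegralPowers.

(** * The stabiliser of an end is virtually cyclic *)

Section EndStabiliser.
Variables (R : realType) (G : groupType) (D : G -> G -> R) (e : R).
Hypothesis hD : hyperbolic_dist D e.
Hypothesis D_left : forall k g h, D (k * g)%g (k * h)%g = D g h.

Definition acylindrical_dist := forall eps : R, 0 < eps ->
  exists (r : R) (N : nat), forall x y : G, r <= D x y ->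
    [set f | D x (f * x)%g <= eps /\ D y (f * y)%g <= eps] #<= `I_N.

Hypothesis acyl : acylindrical_dist.
Variables (a : G) (C kappa : R).
Hypothesis axa : axial D a C kappa.
Implicit Types g h k : G.

Lemma axial_exp_dist i j : (i <= j)%N ->
  (j - i)%:R * kappa <= D (a ^+ i)%g (a ^+ j)%g.
Proof. by move=> /subnKC {2}<-; rewrite (D_exp D_left) (axial_growth axa). Qed.

Lemma axial_unbounded (r : R) : exists J, forall n, (J <= n)%N ->
  r <= D 1%g (a ^+ n)%g.
Proof.
have k0 := axial_pos axa.
have A0 : 0 <= `|r| / kappa by rewrite divr_ge0 ?(ltW k0).
exists (Num.bound (`|r| / kappa)) => n Jn.
rewrite (le_trans _ (axial_growth axa n))// -ler_pdivrMr//.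
rewrite (@le_trans _ _ (`|r| / kappa))//.
  by rewrite ler_pM2r ?invr_gt0// ler_norm.
by rewrite (le_trans (ltW (archi_boundP A0)))// ler_nat.
Qed.

(** Elements [g] fixing the end of the axis shadow it: [g a^j] is within the
uniform shadow radius of some [a^i] as soon as [j] is large. Applied at two
places [j1] and [j2] far apart, this gives two indices [i1] and [i2] whose
difference takes boundedly many values. If it is the same for several [g], then
the [a^-i1 g] nearly agree at two far apart points, hence number
at most [N] by acylindricity; they represent the same cosets as the [g]. *)
Lemma end_stabiliser_cosets :
  finite_set [set zcoset a h | h in [set h | ~ ends_apart D a 1%g h]].
Proof.
have k0 := axial_pos axa.
have [[D0 Dsym] Dtri] := (dist_ge0 hD, dist_sym hD, dist_triangle hD).
set eps := shadow_radius D e a C.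
have eps2 : 0 < 2 * `|eps| + 1 by have := normr_ge0 eps; lra.
have [r [N acylN]] := acyl eps2.
have [J Jr] := axial_unbounded r.
set B := Num.bound ((2 * `|eps| + D 1%g (a ^+ J)%g) / kappa).
have BJ : 2 * `|eps| + D 1%g (a ^+ J)%g < B%:R * kappa.
  rewrite -ltr_pdivrMr// archi_boundP// divr_ge0 ?(ltW k0)//.
  by rewrite addr_ge0 ?mulr_ge0// D0.
set K := ((B + B).+1 * N)%N.
apply: contrapT => /infiniteP/pcard_leP[iota0].
have /choice[iota iotaP] : forall n, exists h,
    ~ ends_apart D a 1%g h /\ zcoset a h = iota0 n.
  by move=> n; have [h ? ?] := @funS _ _ _ _ iota0 n I; exists h.
have iota_inj m n : zcoset a (iota m) = zcoset a (iota n) -> m = n.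
  rewrite (iotaP m).2 (iotaP n).2; apply: 'inj_iota0; exact: in_setT.
have /choice[j0 j0P] : forall n, exists j0, forall j, (j0 <= j)%N ->
    exists i, D (a ^+ i)%g (iota n * a ^+ j)%g <= eps.
  by move=> n; exact: (ray_shadow hD D_left axa (iotaP n).1).
pose j1 := (\max_(n < K.+1) j0 n)%N; pose j2 := (j1 + J)%N.
have /choice[i12 i12P] : forall n, exists i : nat * nat, (n < K.+1)%N ->
    D (a ^+ i.1)%g (iota n * a ^+ j1)%g <= eps /\
    D (a ^+ i.2)%g (iota n * a ^+ j2)%g <= eps.
  move=> n; have [nK|] := ltnP n K.+1; last by exists (0%N, 0%N).
  have j01 : (j0 n <= j1)%N by exact: (leq_bigmax (Ordinal nK)).
  have [i1 i1P] := j0P n j1 j01.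
  by have [i2 i2P] := j0P n j2 (leq_trans j01 (leq_addr _ _)); exists (i1, i2).
have Dj12 : D (a ^+ j1)%g (a ^+ j2)%g = D 1%g (a ^+ J)%g.
  by rewrite (D_exp D_left).
have i12B n : (n < K.+1)%N ->
    ((i12 n).1 <= (i12 n).2 + B)%N /\ ((i12 n).2 <= (i12 n).1 + B)%N.
  move=> /i12P[]; case: (i12 n) => i1 i2 /= H1 H2.
  have near : D (a ^+ i1)%g (a ^+ i2)%g <= 2 * `|eps| + D 1%g (a ^+ J)%g.
    have t1 := Dtri (a ^+ i1)%g (iota n * a ^+ j1)%g (a ^+ i2)%g.
    have t2 := Dtri (iota n * a ^+ j1)%g (iota n * a ^+ j2)%g (a ^+ i2)%g.
    rewrite D_left Dj12 in t2.
    have := ler_norm eps; have := Dsym (iota n * a ^+ j2)%g (a ^+ i2)%g; lra.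
  have close i i' : (i <= i')%N -> D (a ^+ i)%g (a ^+ i')%g
      <= 2 * `|eps| + D 1%g (a ^+ J)%g -> (i' <= i + B)%N.
    move=> ii' le; rewrite -leq_subLR -(ler_nat R) -(ler_pM2r k0).
    by have := axial_exp_dist ii'; lra.
  split; have [le12|/ltnW le21] := leqP i1 i2.
  - by rewrite (leq_trans le12)// leq_addr.
  - by apply: close => //; rewrite Dsym.
  - exact: close.
  - by rewrite (leq_trans le21)// leq_addr.
suff : `I_K.+1 #<= `I_K by rewrite card_le_II ltnn.
apply: (@card_le_fibers _ _ (fun n => (i12 n).2 + B - (i12 n).1)%N) => [n|s].
  by move=> /i12B[]; lia.
set S := _ `&` _.
have [[n0 Sn0]|S0] := pselect (exists n, S n); last first.
  by apply: (@card_le_inj _ _ _ _ id) => [//|n Sn]; case: S0; exists n.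
pose u n := (expgz a (- (i12 n).1%:Z) * iota n)%g.
have uE n : u n = ((a ^+ (i12 n).1)^-1 * iota n)%g.
  by rewrite /u; case: ((i12 n).1) => [|k]//=; rewrite invg1.
have u1 n : S n -> D 1%g (u n * a ^+ j1)%g <= eps.
  move=> [/i12P[H _] _]; rewrite uE -mulgA Dsym (D_translate D_left).
  by rewrite invgK mulg1 Dsym.
pose z := ((a ^+ B)^-1 * a ^+ s)%g.
have u2 n : S n -> D z (u n * a ^+ j2)%g <= eps.
  move=> [nK /= ns]; have [H1 H2] := i12B _ nK; have [_ H] := i12P _ nK.
  rewrite uE -mulgA Dsym (D_translate D_left) invgK Dsym.
  suff -> : (a ^+ (i12 n).1 * z = a ^+ (i12 n).2)%g by [].
  apply: (mulgI (a ^+ B)%g); rewrite /z !mulgA -expgnDr addnC expgnDr mulgK.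
  by rewrite -!expgnDr; congr (_ ^+ _)%g; lia.
apply: (@card_le_trans _ _ _ _ _ _ _ (acylN (a ^+ j1)%g (a ^+ j2)%g _));
  last by rewrite Dj12; exact: Jr.
have near v w x : D v w <= eps -> D v x <= eps -> D w x <= 2 * `|eps| + 1.
  by have := Dtri w v x; rewrite (Dsym w v); have := ler_norm eps; lra.
apply: (@card_le_inj _ _ _ _ (fun n => (u n0)^-1 * u n)%g) => [m n _ _|n Sn].
  move=> /mulgI um; apply: iota_inj.
  by rewrite -(zcoset_mull a (- (i12 m).1%:Z)) -/(u m) um zcoset_mull.
have tr x := D_conj D_left (u n0) (u n) x.
by rewrite /= !tr; split;
  [exact: near (u1 _ Sn0) (u1 _ Sn) | exact: near (u2 _ Sn0) (u2 _ Sn)].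
Qed.

(** Let [t] move the end of the axis. If [g] moves it too, then [g t] fixes it,
for otherwise 1, [t] and [g^-1] would give three distinct ends. So two cosets
of the stabiliser cover the group. *)
Lemma virtually_cyclic_of_two_ends :
    ~ (exists g : 'I_3 -> G,
         forall i j, i != j -> ends_apart D a (g i) (g j)) ->
  virtually_cyclic G.
Proof.
move=> no3; exists a.
set E := [set h | ~ ends_apart D a 1%g h].
have finE : finite_set (zcoset a @` E) := end_stabiliser_cosets.
have [allE|] := pselect (forall g, E g).
  by apply: sub_finite_set finE => _ [g _ <-]; exists g.
move=> /existsNP[t] /contrapT apart_t.
pose shift (A : set G) : set G := [set (x * t^-1)%g | x in A].
apply: (@sub_finite_set _ _ (zcoset a @` E `|` shift @` (zcoset a @` E))).
  move=> _ [g _ <-]; have [Eg|/contrapT apart_g] := pselect (E g).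
    by left; exists g.
  have apart_gV : ends_apart D a 1%g g^-1%g.
    apply: (ends_apart_sym hD); move: apart_g.
    by move=> /(ends_apart_left hD D_left g^-1%g); rewrite mulg1 mulVg.
  right; exists (zcoset a (g * t)%g); last first.
    apply/seteqP; split=> [_ [_ [n _ <-] <-]|_ [n _ <-]].
      by exists n => //; rewrite -mulgA mulgK.
    by exists (expgz a n * (g * t))%g; [exists n | rewrite -mulgA mulgK].
  exists (g * t)%g => // apart_gt; apply: no3.
  have apart_tg : ends_apart D a t g^-1%g.
    apply: (ends_apart_sym hD); move: apart_gt.
    by move=> /(ends_apart_left hD D_left g^-1%g); rewrite mulg1 mulKg.
  exists (fun i : 'I_3 => nth 1%g [:: 1%g; t; g^-1%g] i).
  move=> [[|[|[|]]] //= ?] [[|[|[|]]] //= ?] _ //; exact: (ends_apart_sym hD).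
rewrite finite_setU; split=> //; exact: finite_image.
Qed.

End EndStabiliser.

(** * Connecting elements and the linear bound *)

Lemma finite_set_bounded (R : realType) (T : choiceType) (A : set T)
    (f : T -> R) :
  finite_set A -> exists2 B, 0 <= B & forall x, A x -> f x <= B.
Proof.
move=> /finite_seqP[s ->]; exists (\sum_(x <- s) `|f x|) => [|x /= xs].
  exact: sumr_ge0.
rewrite (big_rem x)//= (le_trans (ler_norm _))// lerDl.
exact: sumr_ge0.
Qed.

Lemma finite_family_bounded (R : realType) (I : finType) (f : I -> R) :
  exists2 B, 0 <= B & forall i, f i <= B.
Proof.
have [B B0 fB] := finite_set_bounded f (@finite_finset I setT).
by exists B => // i; exact: fB.
Qed.

Section Connectors.
Variables (R : realType) (G : groupType) (D : G -> G -> R) (e : R).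
Hypothesis hD : hyperbolic_dist D e.
Hypothesis D_left : forall k g h, D (k * g)%g (k * h)%g = D g h.
Implicit Types a g h k x : G.

Definition connectors (C L : R) (X : 'I_3 -> G) :=
  (forall i, L <= D 1%g (X i)) /\
  forall i j, i != j -> gp D 1%g (X i) (X j) <= C /\
                        gp D 1%g (X i)^-1%g (X j)^-1%g <= C.

Lemma ends_apart_bounded a (g : 'I_3 -> G) :
    (forall i j, i != j -> ends_apart D a (g i) (g j)) ->
  exists2 B, 0 <= B & forall i j, i != j -> forall m n,
    gp D 1%g (g i * a ^+ m)%g (g j * a ^+ n)%g <= B.
Proof.
move=> apart.
have /choice[f fP] : forall ij : 'I_3 * 'I_3, exists B, ij.1 != ij.2 ->
    forall m n, gp D 1%g (g ij.1 * a ^+ m)%g (g ij.2 * a ^+ n)%g <= B.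
  move=> [i j]; have [->|/apart[B BP]] := eqVneq i j; first by exists 0.
  by exists B.
have [B B0 fB] := finite_family_bounded f; exists B => // i j ij m n.
exact: le_trans (fP (i, j) ij m n) (fB _).
Qed.

(** Seen from 1, the element [g a^n h^-1] points towards the end of the ray
[g a^m] and its inverse towards the end of the ray [h a^-m], up to an error
that does not depend on [n]. So three forward and three backward directions
can be prescribed independently, while the length tends to infinity. *)
Lemma connectors_exist a C kappa (g h : 'I_3 -> G) :
    axial D a C kappa ->
    (forall i j, i != j -> ends_apart D a (g i) (g j)) ->
    (forall i j, i != j -> ends_apart D a^-1%g (h i) (h j)) ->
  exists2 B, 0 <= B & forall L, exists X, connectors B L X.
Proof.
move=> axa /ends_apart_bounded[Bg Bg0 gP] /ends_apart_bounded[Bh Bh0 hP].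
have [Lg Lg0 gL] := finite_family_bounded (fun i => D 1%g (g i)).
have [Lh Lh0 hL] := finite_family_bounded (fun i => D 1%g (h i)).
have near x y u v :
    gp D 1%g (x * u^-1)%g (y * v^-1)%g <=
    gp D 1%g x y + 2 * (D 1%g u + D 1%g v).
  have Dx z w : D (z * w^-1)%g z = D 1%g w.
    by rewrite (dist_sym hD) (D_mulr D_left) (D_inv hD D_left).
  have := gp_move_l hD 1%g (x * u^-1)%g x (y * v^-1)%g.
  have := gp_move_l hD 1%g (y * v^-1)%g y x.
  by rewrite !Dx (gp_sym hD _ x) (gp_sym hD _ x); lra.
exists (Bg + Bh + 4 * (Lg + Lh)) => [|L]; first lra.
have [n /(_ n (leqnn n)) nL] := axial_unbounded axa (L + Lg + Lh).
exists (fun i => g i * a ^+ n * (h i)^-1)%g; split=> [i|i j ij].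
  have Dga := D_mul_le hD D_left (g i)^-1%g (g i * a ^+ n)%g.
  have := D_mul_le hD D_left (g i * a ^+ n * (h i)^-1)%g (h i).
  rewrite mulgVK mulKg (D_inv hD D_left) in Dga *.
  by have := gL i; have := hL i; lra.
split; first by have := near (g i * a ^+ n)%g (g j * a ^+ n)%g (h i) (h j);
  have := gP i j ij n n; have := hL i; have := hL j; lra.
have inv (k : 'I_3) :
    ((g k * a ^+ n * (h k)^-1)^-1 = h k * a^-1 ^+ n * (g k)^-1)%g.
  by rewrite !invgM invgK expVgn mulgA.
rewrite !inv; have := near (h i * a^-1 ^+ n)%g (h j * a^-1 ^+ n)%g (g i) (g j).
by have := hP i j ij n n; have := gL i; have := gL j; lra.
Qed.

(** A given direction can be close to at most one of three pairwise separated
directions, so one of the three connectors is good on both sides. *)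
Lemma connector_choice C L X h k : connectors C L X -> exists i,
  gp D 1%g h^-1%g (X i) <= C + e /\ gp D 1%g (X i)^-1%g k <= C + e.
Proof.
move=> [_ XC].
have sep (Y : 'I_3 -> G) y :
    (forall i j, i != j -> gp D 1%g (Y i) (Y j) <= C) -> forall i j, i != j ->
    gp D 1%g (Y i) y <= C + e \/ gp D 1%g (Y j) y <= C + e.
  move=> YC i j /YC Yij; have := dist_four_point hD 1%g (Y i) y (Y j).
  by rewrite (gp_sym hD _ y) => -[]; [left|right]; lra.
have fwd := sep _ h^-1%g (fun i j ij => (XC i j ij).1).
have bwd := sep (fun i => (X i)^-1%g) k (fun i j ij => (XC i j ij).2).
pose o0 : 'I_3 := @Ordinal 3 0 isT; pose o1 : 'I_3 := @Ordinal 3 1 isT.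
pose o2 : 'I_3 := @Ordinal 3 2 isT.
have [[f01 f02] f12] := (fwd o0 o1 isT, fwd o0 o2 isT, fwd o1 o2 isT).
have [[b01 b02] b12] := (bwd o0 o1 isT, bwd o0 o2 isT, bwd o1 o2 isT).
suff [H|[H|H]] :
    (gp D 1%g (X o0) h^-1%g <= C + e /\ gp D 1%g (X o0)^-1%g k <= C + e) \/
    (gp D 1%g (X o1) h^-1%g <= C + e /\ gp D 1%g (X o1)^-1%g k <= C + e) \/
    (gp D 1%g (X o2) h^-1%g <= C + e /\ gp D 1%g (X o2)^-1%g k <= C + e).
- by exists o0; rewrite (gp_sym hD _ h^-1%g).
- by exists o1; rewrite (gp_sym hD _ h^-1%g).
- by exists o2; rewrite (gp_sym hD _ h^-1%g).
by tauto.
Qed.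

(** Let [g = h x k] with [x] a connector adapted to [h] and [k]. Then [h] and
[h x] lie near a geodesic from 1 to [g], at a distance from [g] controlled by
the length of [k]. If two such decompositions of [g] use the same [x] and the
same distance, then [h] and [h'] are close and so are [h x] and [h' x]; as [x]
is long, acylindricity leaves boundedly many possibilities for [h^-1 h']. *)
Lemma linear_ambiguity C : acylindrical_dist D -> 0 <= C ->
    (forall L, exists X, connectors C L X) ->
  exists (X : 'I_3 -> G) (sel : G -> G -> 'I_3) (N B : nat), forall (q : nat) g,
    [set hk : G * G | D 1%g hk.2 <= q%:R /\
       (hk.1 * X (sel hk.1 hk.2) * hk.2 = g)%g] #<= `I_(N * (q + B)).
Proof.
move=> acyl C0 conn; have e0 := dist_defect_ge0 hD.
pose E := C + e; pose eps := 1 + E + 2 * (E + e) + e.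
have eps0 : 0 < eps by rewrite /eps /E; lra.
have [r [N acylN]] := acyl _ eps0.
have [X XP] := conn (`|r| + E + e + 1).
have XL i : `|r| + E + e + 1 <= D 1%g (X i) by exact: XP.1.
have /choice[sel' selP] := fun hk => connector_choice hk.1 hk.2 XP.
pose sel h k := sel' (h, k).
have [B0 B00 B0P] := finite_family_bounded (fun i => D 1%g (X i)).
exists X, sel, (3 * N)%N, (Num.bound B0).+1 => q g.
set B := (Num.bound B0).+1.
rewrite (_ : _ * _ = 3 * ((q + B) * N))%N; last first.
  by rewrite -mulnA (mulnC N).
apply: (@card_le_fibers _ _ (fun hk => sel hk.1 hk.2 : nat)) => [//|i].
apply: (@card_le_fibers _ _ (fun hk => Num.truncn (D g hk.1))) => [[h k]|j].
  move=> [[/= kq <-] _]; set x := X _.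
  rewrite -(ltr_nat R) (le_lt_trans (y := D (h * x * k)%g h))//.
    by rewrite truncn_le (dist_ge0 hD).
  rewrite -mulgA (dist_sym hD) (D_mulr D_left) /B natrD -natr1.
  have := D_mul_le hD D_left x k; have := B0P (sel h k).
  have := archi_boundP B00.
  by rewrite -/x; lra.
set F := _ `&` _.
have [[[h0 k0] F0]|noF] := pselect (exists hk, F hk); last first.
  apply: (@card_le_inj _ _ _ _ (fun=> 0%N)) => [hk hk'|hk Fhk]; last first.
    by case: noF; exists hk.
  by rewrite inE => Fhk; case: noF; exists hk.
pose x := X (sel h0 k0).
have Fsel h k : F (h, k) -> X (sel h k) = x.
  move=> [[_ hk] _]; case: F0 => [[_ hk0] _]; congr X; apply: val_inj.
  by move: hk hk0 => /= -> ->.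
have geom h k : F (h, k) ->
    [/\ gp D h g 1%g <= E + e, gp D (h * x)%g g 1%g <= E + e,
        j%:R <= D g h < j.+1%:R
      & D g h - D 1%g x <= D g (h * x)%g <= D g h - D 1%g x + E].
  move=> Fhk; have Ex := Fsel _ _ Fhk; move: Fhk => [[[_ /= hxk] _] dj].
  have [g1 g2] := selP (h, k); rewrite -/(sel h k) /= Ex in g1 g2 hxk.
  rewrite -(gp_left D_left h) mulgV in g1.
  rewrite -(gp_left D_left (h * x)%g) mulg1 mulgK hxk in g2.
  rewrite mulg1 in g1.
  have [] := gp_chain hD g1 g2.
    by rewrite (D_mulr D_left); have := XL (sel h0 k0); rewrite -/x;
      have := normr_ge0 r; rewrite /E; lra.
  rewrite (gp_sym hD _ 1%g) (gp_sym hD _ 1%g) => c1 c2; split=> //.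
    by rewrite -dj truncn_itv ?(dist_ge0 hD).
  have := dist_triangle hD h (h * x)%g g; move: g2.
  rewrite /gp (D_mulr D_left) (dist_sym hD g h) (dist_sym hD (h * x)%g g).
  by rewrite -/E; lra.
have Dx : r <= D 1%g x.
  by have := XL (sel h0 k0); rewrite -/x; have := ler_norm r; rewrite /E; lra.
apply: (@card_le_trans _ _ _ _ _ _ _ (acylN 1%g x Dx)).
apply: (@card_le_inj _ _ _ _ (fun hk => h0^-1 * hk.1)%g) => [|[h k] Fhk].
  move=> [h k] [h' k']; rewrite !inE => Fhk Fhk' /= /mulgI hh'.
  rewrite -hh' in Fhk' *; have [Ex Ex'] := (Fsel _ _ Fhk, Fsel _ _ Fhk').
  move: Fhk Fhk' => [[[_ /= gE] _] _] [[[_ /= gE'] _] _].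
  by congr pair; apply: (mulgI (h * x)%g); rewrite -{1}Ex gE -Ex' gE'.
have [p1 p2 p3 p4] := geom _ _ F0; have [q1 q2 q3 q4] := geom _ _ Fhk.
rewrite /= !(D_conj D_left) !mulg1 -natr1 in p3 q3 *; split.
  apply: (le_trans (dist_le_of_gp hD p1 q1 (s := 1) _)).
    by rewrite ler_norml; lra.
  by rewrite /eps /E; lra.
apply: (le_trans (dist_le_of_gp hD p2 q2 (s := 1 + E) _)).
  by rewrite ler_norml; lra.
by rewrite /eps /E; lra.
Qed.

End Connectors.

(** * Acylindrical actions *)

Lemma infinite_set_large (T : choiceType) (A : set T) n : infinite_set A ->
  exists S : set T, finite_set S /\ ~ (S #<= `I_n).
Proof.
move=> /(infinite_set_fset n.+1)[F _ nF].
eexists; split; first exact: (finite_fset F).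
by rewrite (card_le_eql (introT card_eq_fsetP erefl)) card_le_II leqNgt nF.
Qed.

Section Action.
Variables (R : realType) (G : groupType) (M : metricType R) (act : G -> M -> M).
Hypothesis isom : isometric_action act.
Implicit Types (f g h : G) (p u : M).

Let act1 p : act 1%g p = p. Proof. by case: isom. Qed.
Let actM g h p : act (g * h)%g p = act g (act h p). Proof. by case: isom. Qed.
Let act_mdist g p u : mdist (act g p) (act g u) = mdist p u.
Proof. by case: isom. Qed.

Lemma hyperbolic_mdist : gromov_hyperbolic M ->
  exists e, hyperbolic_dist (@mdist R M) e.
Proof.
move=> [delta hdelta]; exists (2 * `|delta|); split.
- exact: mdistxx.
- by move=> x y; rewrite metric_sym.
- by move=> x y z; exact: metric_triangle.
- by rewrite mulr_ge0.
move=> w x y z; have := hdelta w x y z; have := ler_norm delta.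
rewrite /gromov_product /gp minEle; case: ifP => _; [left|right]; lra.
Qed.

Let actKV g p : act g (act g^-1%g p) = p.
Proof. by rewrite -actM mulgV act1. Qed.

(** Once a loxodromic element has been found, the geometry that matters is that
of one orbit, carried by the group itself as a left-invariant pseudometric. *)
Definition orbit_dist p g h := mdist (act g p) (act h p).

Lemma orbit_dist_left p k g h :
  orbit_dist p (k * g)%g (k * h)%g = orbit_dist p g h.
Proof. by rewrite /orbit_dist !actM act_mdist. Qed.

Lemma hyperbolic_orbit_dist e p :
  hyperbolic_dist (@mdist R M) e -> hyperbolic_dist (orbit_dist p) e.
Proof.
case=> d0 ds dt e0 d4; split=> //; rewrite /orbit_dist => *; first exact: d0.
- exact: ds.
- exact: dt.
- exact: d4.
Qed.

Lemma acylindrical_orbit_dist p :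
  acylindrical act -> acylindrical_dist (orbit_dist p).
Proof.
move=> acyl eps /acyl[r [N [_ _ rN]]]; exists r, N => x y /rN.
apply: card_le_trans; apply: subset_card_le => f.
by rewrite /orbit_dist /= !actM.
Qed.

Lemma orbit_dist_expgz p f m n : 
  orbit_dist p (expgz f m) (expgz f n) = orbit_dist p 1%g (f ^+ `|m - n|%N)%g.
Proof.
wlog mn : m n / m <= n => [H|].
  have [/H//|/ltW /H] := lerP m n.
  by rewrite /orbit_dist metric_sym => ->; rewrite distnC.
have -> : n = m + `|m - n|%N%:Z by lia.
rewrite expgzD -{1}[expgz f m]mulg1 orbit_dist_left /=.
by congr (orbit_dist _ _ (_ ^+ _)%g); lia.
Qed.

Section Hyperbolic.
Variable e : R.
Hypothesis hd : hyperbolic_dist (@mdist R M) e.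

Lemma axial_loxodromic p f C kappa :
  axial (orbit_dist p) f C kappa -> loxodromic act f.
Proof.
move=> ax; have k0 := axial_pos ax; exists p.
pose L := 1 + orbit_dist p 1%g f + kappa^-1.
have D0 : 0 <= orbit_dist p 1%g f by exact: mdist_ge0.
have kV : 0 < kappa^-1 by rewrite invr_gt0.
exists L, 0; split=> [||m n]; [by rewrite /L; lra | by [] |].
rewrite -/(orbit_dist p _ _) orbit_dist_expgz subr0 addr0.
have -> : (`|m - n|%:~R : R) = `|m - n|%N%:R by rewrite -abszE pmulrn.
apply/andP; split.
  rewrite (le_trans _ (axial_growth ax _))// mulrC ler_wpM2l//.
  by rewrite -[leRHS]invrK lef_pV2 ?posrE// /L; lra.
have hD := hyperbolic_orbit_dist p hd.
rewrite (le_trans (D_exp_le hD (orbit_dist_left p) _ _))//.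
by rewrite mulrC ler_wpM2r// /L; lra.
Qed.

(** Suppose that no square [h^2] moves a point much further than [h] does.
Applied to [g] and [f g], this makes a geodesic from [p] to [g p] and one from
[p] to [f g p] fellow travel, if [g] is long compared with [f]. So [f] slides
the middle of the first geodesic along itself, by some signed distance [sigma],
and [f^2] slides it by [2 sigma]; applied to [f], the assumption now bounds
[sigma]. *)
Lemma displacement_bound p u f g K :
    (forall x h, mdist x (act h (act h x)) <= mdist x (act h x) + 2 * e) ->
    mdist p (act f p) <= K ->
    mdist p u + mdist u (act g p) = mdist p (act g p) ->
    2 * K + 2 * e + 1 <= mdist p u ->
    2 * mdist p u + 4 * K + 6 * e < mdist p (act g p) ->
  mdist u (act f u) <= 14 * e.
Proof.
move=> nolox fK ugeo ufar glong.
have [[e0 ds] dt] := (dist_defect_ge0 hd, dist_sym hd, dist_triangle hd).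
have K0 : 0 <= K by apply: le_trans fK; exact: mdist_ge0.
set gp_ := act g p; set fg := act f gp_; set f_ := act f p.
rewrite -/gp_ in ugeo glong *; rewrite -/f_ in fK.
have gp_far : mdist p gp_ - 2 * K - 4 * e <= gp (@mdist R M) p gp_ fg.
  set X2 := act g^-1%g p; set X3 := act g^-1%g (act f^-1%g p).
  have l2 : mdist p X2 = mdist p gp_ by rewrite -(act_mdist g) actKV ds.
  have lf : mdist p (act f^-1%g p) = mdist p f_.
    by rewrite -(act_mdist f) actKV ds.
  have l3 : mdist p X3 = mdist p fg.
    by rewrite -(act_mdist g) -(act_mdist f) !actKV ds.
  have l23 : mdist X2 X3 = mdist p f_ by rewrite act_mdist lf.
  have l12 : mdist gp_ X2 <= mdist p gp_ + 2 * e.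
    by rewrite -(act_mdist g) actKV ds; exact: nolox.
  have l34 : mdist X3 fg <= mdist p fg + 2 * e.
    rewrite -(act_mdist g) -(act_mdist f) !actKV.
    by have := nolox p (f * g)%g; rewrite !actM.
  have lfg : mdist p gp_ - K <= mdist p fg.
    have := dt fg f_ p; rewrite act_mdist => ?.
    by have := ds fg p; have := ds gp_ p; have := ds f_ p;
       have := dt f_ p fg; have := act_mdist f p gp_; rewrite -/f_ -/fg; lra.
  have [] := (ds X2 p, ds X3 p); have [] := (ds fg p, ds gp_ p) => s1 s2 s3 s4.
  have := dist_four_point hd p gp_ X3 fg.
  have := dist_four_point hd p gp_ X2 X3.
  by rewrite /gp => -[] ? [] ?; lra.
set v := act f u; set z := act f v.
have vf : mdist v f_ = mdist p u by rewrite ds act_mdist.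
have vfg : mdist fg v = mdist u gp_ by rewrite ds act_mdist.
have zf : mdist z f_ = mdist p v by rewrite ds act_mdist.
have zfg : mdist fg z = mdist v gp_ by rewrite ds act_mdist.
have ffg : mdist f_ fg = mdist p gp_ by rewrite act_mdist.
have [s1 s2] := (ds f_ v, ds f_ z).
(* The point [v = f u] lies near a geodesic from p to f g p, and near one from
p to g p because these two fellow travel. *)
have v1 : gp (@mdist R M) v p fg <= e.
  have := dist_four_point hd v f_ p fg; have := dt f_ p v; have := dt p f_ v.
  by rewrite /gp (ds f_ p) => ? ? []; lra.
have v2 : gp (@mdist R M) v p gp_ <= 2 * e.
  have := gp_move_base hd v p gp_ fg; have := dt p f_ v.
  by have [] := dist_four_point hd v p gp_ fg; lra.
have z1 : gp (@mdist R M) z p fg <= 3 * e.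
  have := dist_four_point hd z f_ p fg; have := dt f_ p z; have := dt f_ p v.
  by move: v2; rewrite /gp (ds f_ p) (ds gp_ v) => ? ? ? []; lra.
(* Positions along the geodesics: [v] is at distance [sigma] further than [u],
and [z] at distance [2 sigma], up to multiples of [e]. *)
pose sigma := mdist p fg - mdist p gp_.
have v3 : `|mdist p u - mdist p v| <= `|sigma| + e.
  have := dt p v fg; move: v1; rewrite /gp (ds v fg) /sigma => ? ?.
  have := ler_norm sigma; have := ler_norm (- sigma).
  by rewrite normrN /sigma ler_norml; lra.
have u0 : gp (@mdist R M) u p gp_ <= 0.
  by rewrite /gp (ds gp_ u); lra.
have uv := dist_le_of_gp hd u0 v2 v3.
have uz : mdist u z <= mdist u v + 2 * e by exact: nolox.
have := dt p v gp_; have := dt p z fg; have := dt p v fg.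
have := dt p u z; have := dt p z u; move: v1 v2 z1.
rewrite /gp (ds gp_ v) (ds v fg) (ds z fg) (ds z u) => ? ? ? ? ? ? ? ?.
suff : `|sigma| <= 10 * e by lra.
by move: uv; case: (ger0P sigma); rewrite /sigma => ? ?; lra.
Qed.

(** Otherwise arbitrarily many elements would all almost fix two points far
apart on a long geodesic. *)
Lemma bounded_orbits_of_no_axis :
    geodesic_space M -> acylindrical act ->
    (forall x h, mdist x (act h (act h x)) <= mdist x (act h x) + 2 * e) ->
  bounded_orbits act.
Proof.
move=> geo acyl nolox p; apply: contrapT => unb.
have e0 := dist_defect_ge0 hd.
have far (C : R) : exists g, C < mdist p (act g p).
  apply: contrapT => nofar; apply: unb; exists C => g; rewrite leNgt.
  by apply/negP => Cg; apply: nofar; exists g.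
have infG : infinite_set [set: G].
  move=> /(finite_set_bounded (fun g => mdist p (act g p)))[B _ GB].
  by have [g] := far B; rewrite ltNge GB.
have eps0 : 0 < 14 * e + 1 by lra.
have [r [N [r0 _ rN]]] := acyl _ eps0.
have [F [finF NF]] := infinite_set_large N infG.
have [K K0 FK] := finite_set_bounded (fun g => mdist p (act g p)) finF.
pose t1 := 2 * K + 2 * e + 1; pose t2 := t1 + r.
have [g gfar] := far (2 * t2 + 4 * K + 6 * e).
have [c [c0 cT cdist]] := geo p (act g p).
move TE : (mdist p (act g p)) gfar cT cdist => T gfar cT cdist.
have cP t : t1 <= t <= t2 -> mdist p (c t) = t /\
    forall f, F f -> mdist (c t) (act f (c t)) <= 14 * e + 1.
  rewrite /t2 /t1 in gfar *; move=> /andP[t1t tt2].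
  have r_ge0 : 0 <= r by exact: ltW.
  have [[t0 tT] T0] : (0 <= t /\ t <= T) /\ 0 <= T by split; [split|]; lra.
  have ptE : mdist p (c t) = t.
    rewrite -{1}c0 cdist ?sub0r ?normrN ?ger0_norm// in_itv/=.
      by rewrite lexx T0.
    by rewrite t0 tT.
  have tgE : mdist (c t) (act g p) = T - t.
    rewrite -cT cdist ?in_itv/= ?t0 ?tT ?T0 ?lexx//.
    by rewrite distrC ger0_norm// subr_ge0.
  split=> // f /FK fK.
  rewrite (le_trans (displacement_bound (g := g) nolox fK _ _ _))//;
    by rewrite ?ptE ?tgE ?TE; lra.
have [|p1 f1] := cP t1; first by rewrite lexx lerDl ltW.
have [|p2 f2] := cP t2; first by rewrite lexx lerDl ltW.
have c12 : r <= mdist (c t1) (c t2).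
  by have := dist_triangle hd p (c t1) (c t2); rewrite p1 p2 /t2; lra.
apply: NF; apply: card_le_trans (rN _ _ c12); apply: subset_card_le => f Ff.
by split; [exact: f1 | exact: f2].
Qed.

End Hyperbolic.
End Action.

(** * Ambiguity in one factor *)

(** The length [len] is the displacement of a base point chosen so that some
element translates its orbit. Being subadditive, it is at most a multiple of
the word length for any finite generating set. *)
Lemma acylindrically_hyperbolic_ambiguity (R : realType) (G : groupType) :
    acylindrically_hyperbolic R G ->
  exists len : G -> R,
    [/\ len 1%g = 0, forall g, len g^-1%g = len g
      & forall g h, len (g * h)%g <= len g + len h] /\
  exists (X : 'I_3 -> G) (sel : G -> G -> 'I_3) (N B : nat), forall (q : nat) g,
    [set hk : G * G | len hk.2 <= q%:R /\
       (hk.1 * X (sel hk.1 hk.2) * hk.2 = g)%g] #<= `I_(N * (q + B)).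
Proof.
move=> [M [act [[geo hypM] isom acyl nonelem]]].
have [e hd] := hyperbolic_mdist hypM.
have [p [f pf]] : exists p f,
    mdist p (act f p) + 2 * e < mdist p (act f (act f p)).
  apply: contrapT => nolox; apply: nonelem; left.
  apply: (bounded_orbits_of_no_axis isom hd geo acyl) => p f.
  by rewrite leNgt; apply/negP => pf; apply: nolox; exists p, f.
pose D := orbit_dist act p.
have hD : hyperbolic_dist D e := hyperbolic_orbit_dist act p hd.
have DL : forall k g h, D (k * g)%g (k * h)%g = D g h := orbit_dist_left isom p.
have acylD : acylindrical_dist D := acylindrical_orbit_dist isom p acyl.
have f_long : D 1%g f + 2 * e < D 1%g (f ^+ 2)%g.
  by case: isom => a1 aM _; rewrite /D /orbit_dist a1 expg2 aM.
have fV_long : D 1%g f^-1%g + 2 * e < D 1%g (f^-1 ^+ 2)%g.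
  by rewrite expVgn !(D_inv hD DL).
have axf := axial_criterion hD DL f_long.
have axfV := axial_criterion hD DL fV_long.
have not_vc : ~ virtually_cyclic G.
  move=> vc; apply: nonelem; right; split=> //; exists f.
  exact: (axial_loxodromic isom hd axf).
have three a C kappa : axial D a C kappa -> exists g : 'I_3 -> G,
    forall i j, i != j -> ends_apart D a (g i) (g j).
  move=> axa; apply: contrapT => no3.
  exact/not_vc/(virtually_cyclic_of_two_ends hD DL acylD axa no3).
have [[g gP] [h hP]] := (three _ _ _ axf, three _ _ _ axfV).
have [C C0 conn] := connectors_exist hD DL axf gP hP.
exists (D 1%g); split; last exact: (linear_ambiguity hD DL acylD C0 conn).
split; [exact: (dist_refl hD) | exact: (D_inv hD DL) | exact: (D_mul_le hD DL)].
Qed.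

(** * Products *)

Lemma card_le_joint_injective (T : Type) (I : eqType) (c : I -> nat)
    (phi : I -> T -> nat) (s : seq I) (S : set T) :
    (forall i x, S x -> (phi i x < c i)%N) ->
    (forall x y, S x -> S y -> {in s, forall i, phi i x = phi i y} -> x = y) ->
  S #<= `I_(\prod_(i <- s) c i).
Proof.
elim: s S => [|i s IHs] S phic inj.
  rewrite big_nil; apply: (@card_le_inj _ _ _ _ (fun=> 0%N)) => // x y.
  by rewrite !inE => Sx Sy _; apply: inj.
rewrite big_cons; apply: (@card_le_fibers _ _ (phi i)) => [x /phic//|j].
apply: IHs => [k x [/phic]//|x y [Sx /= xj] [Sy /= yj] xy].
by apply: inj => // k; rewrite inE => /predU1P[->|/xy//]; rewrite xj.
Qed.

Lemma gprodM n (G : 'I_n -> groupType) (x y : gprod G) i :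
  (x * y)%g i = (x i * y i)%g.
Proof. exact: ffunE. Qed.

Lemma gprodV n (G : 'I_n -> groupType) (x : gprod G) i : x^-1%g i = (x i)^-1%g.
Proof. exact: ffunE. Qed.

Lemma gprod1 n (G : 'I_n -> groupType) i : (1%g : gprod G) i = 1%g.
Proof. exact: ffunE. Qed.

Lemma word_length_represents (G : groupType) (X : set G) g : generates X ->
  exists2 s, represents X s g & size s = word_length X g.
Proof.
move=> /(_ g)[s sg]; rewrite /word_length; case: pselect => [ex|[]]; last first.
  by exists (size s); apply/asboolP; exists s.
by case: ex_minnP => n /asboolP[s' s'g <-] _; exists s'.
Qed.

Lemma length_le_word_length (R : realType) (G H : groupType) (X : set G)
    (pi : G -> H) (len : H -> R) :
    finite_set X -> generates X -> pi 1%g = 1%g ->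
    {morph pi : x y / (x * y)%g >-> (x * y)%g} -> 
    {morph pi : x / x^-1%g >-> x^-1%g} -> 
    len 1%g = 0 -> (forall h, len h^-1%g = len h) ->
    (forall g h, len (g * h)%g <= len g + len h) ->
  exists A : nat, forall g, len (pi g) <= (A * word_length X g)%:R.
Proof.
move=> finX genX pi1 piM piV len1 lenV lenM.
have [A A0 XA] := finite_set_bounded (len \o pi) finX.
exists (Num.bound A) => g; have [s [sX <-] <-] := word_length_represents g genX.
elim: s sX => [|x s IHs] sX; first by rewrite big_nil pi1 len1 muln0.
rewrite big_cons piM (le_trans (lenM _ _))//= mulnS natrD lerD//.
  apply: le_trans (ltW (archi_boundP A0)).
  have [/XA//|/XA] := sX x (mem_head _ _).
  by rewrite /= piV lenV.
by apply: IHs => y ys; apply: sX; rewrite inE ys orbT.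
Qed.

Lemma size_prod_linear (R : realType) n (a b : 'I_n -> R) :
    (forall i, a i != 0) ->
  size (\prod_i (a i *: 'X + (b i)%:P)) = n.+1.
Proof.
move=> a0; have sz i : size (a i *: 'X + (b i)%:P) = 2%N.
  rewrite size_polyDl size_scale ?size_polyX//.
  by rewrite ltnS size_polyC leq_b1.
rewrite size_prod => [|i _]; last by rewrite -size_poly_eq0 sz.
rewrite (eq_bigr (fun=> 2%N)) => [|i _]; last exact: sz.
by rewrite sum_nat_const !card_ord; lia.
Qed.

Theorem theorem1p4 (R : realType) (n : nat) (G : 'I_n -> groupType)
    (Gfg : forall i, finitely_generated (G i))
    (Gah : forall i, acylindrically_hyperbolic R (G i))
    (X : set (gprod G)) (Xfin : finite_set X) (Xgen : generates X) :
  exists2 f : nat -> nat, ambiguity_function X f &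
    exists2 P : {poly R}, size P = n.+1 &
      forall q : nat, (f q)%:R <= P.[q%:R].
Proof.
have factor i : {F : ('I_3 -> G i) * (G i -> G i -> 'I_3) * (nat * nat * nat) |
    forall (q : nat) g, [set hk : G i * G i |
      (exists2 k : gprod G, (word_length X k <= q)%N & hk.2 = k i) /\
      (hk.1 * F.1.1 (F.1.2 hk.1 hk.2) * hk.2 = g)%g]
        #<= `I_(F.2.1.1 * (F.2.1.2 * q + F.2.2))}.
  apply: cid; have [len [[len1 lenV lenM]]] :=
    acylindrically_hyperbolic_ambiguity (Gah i).
  move=> [conn [sel [N [B ball_le]]]].
  have [A lenA] :=
    length_le_word_length (pi := fun x : gprod G => x i) Xfin Xgen (gprod1 G i)
    (fun x y => gprodM x y i) (fun x => gprodV x i) len1 lenV lenM.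
  exists (conn, sel, (N, A, B)) => q g /=.
  apply: card_le_trans (ball_le (A * q)%N g); apply: subset_card_le => -[h k].
  move=> [/= [k' k'q ->] hk]; split=> //=; apply: le_trans (lenA k') _.
  by rewrite ler_nat leq_mul2l k'q orbT.
pose conn i := (sval (factor i)).1.1; pose sel i := (sval (factor i)).1.2.
pose N i := (sval (factor i)).2.1.1; pose A i := (sval (factor i)).2.1.2.
pose B i := (sval (factor i)).2.2.
(* The successors make every factor a polynomial of degree exactly 1. *)
pose c i q := ((N i).+1 * ((A i).+1 * q + B i))%N.
have ambi i (q : nat) g : [set hk : G i * G i |
    (exists2 k : gprod G, (word_length X k <= q)%N & hk.2 = k i) /\
    (hk.1 * conn i (sel i hk.1 hk.2) * hk.2 = g)%g] #<= `I_(c i q).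
  apply: card_le_trans (svalP (factor i) q g) _.
  by rewrite card_le_II leq_mul// leq_add2r leq_mul2r leqnSn orbT.
exists (fun q => \prod_i c i q)%N; last first.
  exists (\prod_i (((N i).+1 * (A i).+1)%:R *: 'X + ((N i).+1 * B i)%:R%:P)).
    by apply: size_prod_linear => i; rewrite pnatr_eq0.
  move=> q; rewrite natr_prod horner_prod le_eqVlt; apply/predU1P; left.
  apply: eq_bigr => i _.
  by rewrite !hornerE /c mulnDr mulnA natrD !natrM.
pose connect (s : {ffun 'I_n -> 'I_3}) : gprod G := [ffun i => conn i (s i)].
exists (fun h k : gprod G => h * connect [ffun i => sel i (h i) (k i)] * k)%g.
  exists (\max_s word_length X (connect s)) => h k _ _.
  exists (connect [ffun i => sel i (h i) (k i)]) => //; split=> //.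
  exact: leq_bigmax.
move=> p q g _; set S := [set hk | _].
have /= phiP i := cid2 (card_le_II_inj (ambi i q (g i))).
pose phi i (hk : gprod G * gprod G) := s2val (phiP i) (hk.1 i, hk.2 i).
have Si i hk : S hk -> 
    [set hk : G i * G i |
    (exists2 k : gprod G, (word_length X k <= q)%N & hk.2 = k i) /\
    (hk.1 * conn i (sel i hk.1 hk.2) * hk.2 = g i)%g] (hk.1 i, hk.2 i).
  move=> [_ [_ kq] <-]; split; first by exists hk.2.
  by rewrite !gprodM !ffunE.
apply: (@card_le_joint_injective _ _ (c^~ q) phi).
  by move=> i hk /(Si i); exact: (s2valP' (phiP i)).
move=> [h k] [h' k'] Shk Shk' eqphi.
suff hk i : (h i, k i) = (h' i, k' i).
  by congr pair; apply/ffunP => i; have [] := hk i.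
apply: (s2valP (phiP i)); rewrite ?inE.
- exact: (Si i _ Shk).
- exact: (Si i _ Shk').
- by apply: eqphi; exact: mem_index_enum.
Qed.
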